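(* Let $H = (V, A, B)$ be a cross-intersecting family such that there is no pair $e_1, e_2 \in A \cup B$ with $e_1 \subsetneq e_2$ (i.e. $(V, A \cup B)$ is a Sperner system). Then $\chi(H) \leq 3$ or, up to exchanging the roles of $A$ and $B$, $V = \{v_1, \dots, v_m, u_1, \dots, u_l\}$, $B = \{ \{v_1, \dots, v_m\}, \{u_1, \dots, u_l\} \}$ and $A = \{ \{v_i, u_j\} \text{ for all } i, j \}$, where $m, l \geq 2$.
   Context: A hypergraph is a pair $(V,E)$ where $V$ is a set of vertices and $E$ is a set of subsets of $V$ (edges). A cross-intersecting family $H = (V, A, B)$ is a hypergraph with vertex set $V$ and edge set $E = A \cup B$ such that every $a \in A$ intersects every $b \in B$, and $A$, $B$ are not empty. A coloring of the vertices of $H$ is proper if there are no monochromatic edges; the chromatic number $\chi(H)$ is the minimal number of colors that admits a proper coloring.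
   Formalization: V is taken finite, and χ(H) is assumed to exist (no one-vertex edges); in the exceptional case, only the set of non-isolated vertices of V is claimed to be {v_1,…,v_m,u_1,…,u_l}, since an extra vertex lying in no edge (e.g. added to K_4) makes the literal claim false. *)

(* Defs.v *)
From mathcomp Require Import all_boot.

Set Implicit Arguments.
Unset Strict Implicit.
Unset Printing Implicit Defensive.

(** A finite hypergraph is a finite vertex type [V] together with its set of
    edges [E : {set {set V}}]. *)

Definition cross_intersecting (V : finType) (A B : {set {set V}}) : Prop :=
  [/\ A != set0, B != set0 &
      forall a b : {set V}, a \in A -> b \in B -> a :&: b != set0].

Definition sperner (V : finType) (E : {set {set V}}) : Prop :=
  forall e1 e2 : {set V}, e1 \in E -> e2 \in E -> ~~ (e1 \proper e2).

(** Singletons (and the empty set) count as monochromatic. *)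
Definition monochromatic (V : finType) (k : nat) (c : {ffun V -> 'I_k})
    (e : {set V}) : bool :=
  [forall x in e, forall y in e, c x == c y].

Definition proper_coloring (V : finType) (k : nat) (E : {set {set V}})
    (c : {ffun V -> 'I_k}) : bool :=
  [forall e in E, ~~ monochromatic c e].

Definition colorable (V : finType) (E : {set {set V}}) (k : nat) : bool :=
  [exists c : {ffun V -> 'I_k}, proper_coloring E c].

(** The minimum exists only if some proper coloring does, which fails exactly
    when some edge has at most one vertex; hence the explicit argument. *)
Definition chi (V : finType) (E : {set {set V}})
    (hE : exists k, colorable E k) : nat :=
  ex_minn hE.

Definition isolated (V : finType) (E : {set {set V}}) : {set V} :=
  [set x | [forall e in E, x \notin e]].

(** Isolated vertices change neither the edges nor the chromatic number, so the
    vertex set can only be determined up to them; if there are none, the vertex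
    condition below reads [[set: V] = [set v i | i : 'I_m] :|: [set u j | j : 'I_l]]. *)
Definition exceptional (V : finType) (A B : {set {set V}}) : Prop :=
  exists (m l : nat) (v : 'I_m -> V) (u : 'I_l -> V),
    [/\ 2 <= m /\ 2 <= l,
        [/\ injective v, injective u & forall i j, v i != u j],
        [set: V] :\: isolated (A :|: B) =
          [set v i | i : 'I_m] :|: [set u j | j : 'I_l],
        B = [set [set v i | i : 'I_m]; [set u j | j : 'I_l]] &
        A = [set [set v i; u j] | i : 'I_m, j : 'I_l]].

(* Main.v *)
(** Suppose [A :|: B] is not 3-colorable, so that whenever three sets cover the
    vertices, one of them contains an edge. For [a] in [A] and [b] in [B], the
    complement of [a :|: b] contains no edge, and neither does a proper subset
    of [a] or [b]. The covers made of pieces of [a], of [b] and of this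
    complement show first that [a] and [b] share exactly one vertex [x], then
    that every [z] in [b] lies in an edge meeting [a :|: b] at most in [z], and
    finally that if the edge obtained for [z = x] lies in [B] (resp. [A]), then
    [b] (resp. [a]) has only two vertices. Hence one of the families, say [A],
    is a graph. It is bipartite between two disjoint members [b0], [b1] of [B].
    If it is complete bipartite, we are done. Otherwise a non-adjacent pair
    [x, y] must itself belong to [B], which forces [b0] and [b1] to have two
    vertices each and [B] to be a 4-cycle, the exceptional case with the roles
    exchanged. *)

Require Import Defs.
From mathcomp Require Import all_boot.

Set Implicit Arguments.
Unset Strict Implicit.
Unset Printing Implicit Defensive.

(** The lower bound on edge sizes is what the proof retains from the existence of a proper coloring.
    The notion is symmetric in [A] and [B], so each lemma below can be used with the roles
    exchanged. *)
Definition obstruction (V : finType) (A B : {set {set V}}) : Prop :=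
  [/\ cross_intersecting A B, sperner (A :|: B),
      forall e, e \in A :|: B -> 1 < #|e| & ~~ colorable (A :|: B) 3].

Lemma obstructionC (V : finType) (A B : {set {set V}}) :
  obstruction A B -> obstruction B A.
Proof.
rewrite /obstruction setUC => -[[A0 B0 AB] sp sz col]; split=> //; split=> // b a bB aA.
by rewrite setIC AB.
Qed.

Lemma colorable_card_gt1 (V : finType) (E : {set {set V}}) (k : nat) (e : {set V}) :
  colorable E k -> e \in E -> 1 < #|e|.
Proof.
case/existsP=> c /forall_inP cP /cP; apply: contraR; rewrite -leqNgt => /card_le1_eqP e1.
by apply/forall_inP=> x xe; apply/forall_inP=> y ye; rewrite (e1 x y).
Qed.

Lemma chi_le (V : finType) (E : {set {set V}}) (hE : exists k, colorable E k) (k : nat) :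
  colorable E k -> chi hE <= k.
Proof. by move=> Ek; rewrite /chi; case: ex_minnP => n _; apply. Qed.

(* The sets need not be disjoint: a vertex takes the color of the first one
   containing it. *)
Lemma cover_colorable3 (V : finType) (E : {set {set V}}) (P Q R : {set V}) :
  (forall x, [|| x \in P, x \in Q | x \in R]) ->
  (forall e, e \in E -> [&& ~~ (e \subset P), ~~ (e \subset Q) & ~~ (e \subset R)]) ->
  colorable E 3.
Proof.
move=> PQR nE.
pose c := [ffun x => if x \in P then inord 0 else if x \in Q then inord 1
                     else inord 2 : 'I_3].
have cE x : val (c x) = if x \in P then 0 else if x \in Q then 1 else 2.
  by rewrite ffunE; case: ifP => _; [|case: ifP => _]; rewrite /= inordK.
apply/existsP; exists c; apply/forall_inP=> e /nE /and3P[nP nQ nR].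
apply/negP=> /forall_inP mono.
case/subsetPn: nP => x xe xP; case/subsetPn: nQ => y ye yQ; case/subsetPn: nR => z ze zR.
have exy : val (c x) = val (c y) by move/forall_inP: (mono x xe) => /(_ y ye)/eqP->.
have exz : val (c x) = val (c z) by move/forall_inP: (mono x xe) => /(_ z ze)/eqP->.
move: exy exz (PQR x) (PQR y) (PQR z); rewrite !cE (negPf xP) (negPf yQ) (negPf zR).
by case: (x \in Q); case: (y \in P); case: (z \in P); case: (z \in Q).
Qed.

(** * Intersections and sizes of edges when three colors do not suffice *)

Section Obstruction.
Variables (V : finType) (A B : {set {set V}}).
Hypothesis obs : obstruction A B.

Lemma obstruction_cover (P Q R : {set V}) :
  (forall x, [|| x \in P, x \in Q | x \in R]) ->
  exists2 e, e \in A :|: B & [|| e \subset P, e \subset Q | e \subset R].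
Proof.
move=> PQR; case: obs => _ _ _ nc; apply/exists_inP; apply: contraR nc.
rewrite negb_exists_in => /forall_inP nE.
by apply: (cover_colorable3 PQR) => e /nE; rewrite !negb_or.
Qed.

Lemma obstruction_meet (a b : {set V}) :
  a \in A -> b \in B -> exists2 x, x \in a & x \in b.
Proof.
case: obs => -[_ _ AB] _ _ _ aA bB.
by have /set0Pn[x /setIP[xa xb]] := AB a b aA bB; exists x.
Qed.

Lemma obstruction_eq (e f : {set V}) :
  e \in A :|: B -> f \in A :|: B -> e \subset f -> e = f.
Proof.
case: obs => _ sp _ _ eE fE ef; apply/eqP; rewrite eqEsubset ef /=.
by have := sp e f eE fE; rewrite properE ef negbK.
Qed.

Lemma obstruction_setD1 (e f : {set V}) (x : V) :
  e \in A :|: B -> f \in A :|: B -> x \in f -> ~~ (e \subset f :\ x).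
Proof.
move=> eE fE xf; apply/negP=> /subsetD1P[ef /negP]; apply.
by rewrite (obstruction_eq eE fE ef).
Qed.

Lemma obstruction_other (e : {set V}) (x : V) :
  e \in A :|: B -> exists2 y, y \in e & y != x.
Proof.
case: obs => _ _ sz _ /sz; rewrite (cardsD1 x) => e1.
have /card_gt0P[y] : 0 < #|e :\ x| by move: e1; case: (x \in e) => // /ltnW.
by rewrite !inE => /andP[yx ye]; exists y.
Qed.

Lemma obstruction_outside (a b e : {set V}) :
  a \in A -> b \in B -> e \in A :|: B -> ~~ (e \subset ~: (a :|: b)).
Proof.
move=> aA bB /setUP[eA|eB]; apply/negP=> /subsetP se.
  have [x xe xb] := obstruction_meet eA bB.
  by move: (se x xe); rewrite !inE xb orbT.
have [x xa xe] := obstruction_meet aA eB.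
by move: (se x xe); rewrite !inE xa.
Qed.

(** With two common vertices, [a :\ x] still covers [y] and [b :\ y] still covers [x], so together
    with the outside of [a :|: b] they form a cover without edges. *)
Lemma obstruction_inter1 (a b : {set V}) (x y : V) :
  a \in A -> b \in B -> x \in a -> x \in b -> y \in a -> y \in b -> x = y.
Proof.
move=> aA bB xa xb ya yb; apply/eqP/negPn/negP=> xy.
have aE : a \in A :|: B by rewrite inE aA.
have bE : b \in A :|: B by rewrite inE bB orbT.
have [w|e eE] := @obstruction_cover (a :\ x) (b :\ y) (~: (a :|: b)).
  rewrite !inE; have [->|_] := eqVneq w x; first by rewrite xy xb.
  have [->|_] := eqVneq w y; first by rewrite ya.
  by case: (w \in a); case: (w \in b).
by rewrite (negPf (obstruction_setD1 eE aE xa)) (negPf (obstruction_setD1 eE bE yb))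
  (negPf (obstruction_outside aA bB eE)).
Qed.

(** In the cover by [a :\ x], [b :\ z] and the third set, the Sperner property leaves only the third
    set to contain an edge. *)
Lemma obstruction_private (a b : {set V}) (x z : V) :
  a \in A -> b \in B -> x \in a -> x \in b -> z \in b ->
  exists2 e, e \in A :|: B & e \subset z |: ~: (a :|: b).
Proof.
move=> aA bB xa xb zb.
have aE : a \in A :|: B by rewrite inE aA.
have bE : b \in A :|: B by rewrite inE bB orbT.
have [w|e eE] := @obstruction_cover (a :\ x) (b :\ z) (z |: ~: (a :|: b)).
  rewrite !inE; case: (w == z); rewrite ?orbT //=.
  have [->|_] := eqVneq w x; first by rewrite xb.
  by case: (w \in a); case: (w \in b).
rewrite (negPf (obstruction_setD1 eE aE xa)) (negPf (obstruction_setD1 eE bE zb)) /=.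
by move=> ez; exists e.
Qed.

(** An edge of [B] in that set could meet [a] only at [z], but [x] is the only common vertex of [a]
    and [b]. *)
Lemma obstruction_private_neq (a b : {set V}) (x z : V) :
  a \in A -> b \in B -> x \in a -> x \in b -> z \in b -> z != x ->
  exists2 a', a' \in A & a' \subset z |: ~: (a :|: b).
Proof.
move=> aA bB xa xb zb zx.
have [e /setUP[eA|eB] /subsetP se] := obstruction_private aA bB xa xb zb.
  by exists e => //; apply/subsetP.
have [w wa we] := obstruction_meet aA eB.
move: (se w we); rewrite !inE wa orbF => /eqP wz.
by rewrite -(obstruction_inter1 aA bB xa xb (y := z)) ?eqxx // -wz in zx.
Qed.

(** Two vertices [z], [z'] of [b] besides [x] would have private edges in [A]. These edges and [e]
    rule out the cover obtained by moving [y] from [a] to the side of [b], and [z] the other way. *)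
Lemma obstruction_private_card (a b e : {set V}) (x : V) :
  a \in A -> b \in B -> x \in a -> x \in b ->
  e \in B -> e \subset x |: ~: (a :|: b) -> #|b| <= 2.
Proof.
move=> aA bB xa xb eB /subsetP ex; rewrite leqNgt; apply/negP=> b3.
have aE : a \in A :|: B by rewrite inE aA.
have bE : b \in A :|: B by rewrite inE bB orbT.
have [z zb zx] := obstruction_other x bE.
have [y ya yx] := obstruction_other x aE.
have [z' zb' /andP[zx' zz']] : exists2 z', z' \in b & (z' != x) && (z' != z).
  have /card_gt0P[z'] : 0 < #|b :\ x :\ z|.
    by move: b3; rewrite (cardsD1 x) xb (cardsD1 z) !inE zx zb.
  by rewrite !inE => /and3P[? ? ?]; exists z' => //; apply/andP.
have ab1 w : w \in a -> w \in b -> w = x.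
  by move=> wa wb; apply: (obstruction_inter1 aA bB).
have exE w : w \in e -> w \in a :|: b -> w = x.
  by move=> /ex; rewrite !inE => /orP[/eqP//|/negPf->].
have [az azA /subsetP saz] := obstruction_private_neq aA bB xa xb zb zx.
have [az' azA' /subsetP saz'] := obstruction_private_neq aA bB xa xb zb' zx'.
have yb : y \notin b by apply: contra yx => /(ab1 y ya) ->.
(* An edge inside the first or the third set is excluded because it has to
   meet [e], if in [A], and the edge [az] or [az'], if in [B]. *)
have [w|f fE] := @obstruction_cover (y |: b :\ x :\ z) (~: (a :|: b)) (z |: a :\ y).
  rewrite !inE; have [->|_] := eqVneq w y; first by [].
  have [->|_] := eqVneq w z; first by rewrite !orbT.
  have [->|_] := eqVneq w x; first by rewrite xa !orbT.
  by case: (w \in a); case: (w \in b).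
rewrite (negPf (obstruction_outside aA bB fE)) /=.
case/setUP: (fE) => [fA|fB] /orP[/subsetP sf|/subsetP sf].
- have [w wf we] := obstruction_meet fA eB.
  move: (sf w wf) (exE w we); rewrite !inE => /orP[/eqP->|/and3P[_ /negPf nwx wb]].
    by rewrite ya => /(_ isT)/eqP; rewrite (negPf yx).
  by rewrite wb orbT => /(_ isT)/eqP; rewrite nwx.
- have [w wf we] := obstruction_meet fA eB.
  (* Since [f] meets [e] only at [x], it cannot also contain [z], a second vertex of [b]; hence [f]
     lies in [a :\ y]. *)
  have wx : w = x.
    by apply: exE we _; move: (sf w wf); rewrite !inE => /orP[/eqP->|/andP[_ ->]//]; rewrite zb orbT.
  have zf : z \notin f.
    by apply: contra zx => zf; rewrite (obstruction_inter1 fA bB zf zb _ xb) // -wx.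
  have/negP[] := obstruction_setD1 fE aE ya; apply/subsetP=> v vf.
  by move: (sf v vf); rewrite !inE; have [vz|//] := eqVneq v z; rewrite vz (negPf zf) in vf.
- have [w waz wf] := obstruction_meet azA fB.
  move: (sf w wf) (saz w waz); rewrite !inE => /orP[/eqP->|/and3P[/negPf-> _ ->]].
    by rewrite ya orbF => /eqP yz; rewrite yz zb in yb.
  by rewrite orbT.
- have [w waz wf] := obstruction_meet azA' fB.
  move: (sf w wf) (saz' w waz); rewrite !inE => /orP[/eqP->|/andP[_ wa]].
    by rewrite zb orbT orbF eq_sym (negPf zz').
  rewrite wa orbF => /eqP wz'.
  by rewrite -wz' (ab1 w) ?eqxx // wz' in zx'.
Qed.

End Obstruction.

(** Once some [a] has three vertices, the private edge at the common vertex of [a] and any [b]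
    cannot lie in [A]; it lies in [B] and bounds [b]. *)
Lemma obstruction_card2 (V : finType) (A B : {set {set V}}) :
  obstruction A B ->
  (forall a, a \in A -> #|a| <= 2) \/ (forall b, b \in B -> #|b| <= 2).
Proof.
move=> obs.
have [/forall_inP|] := boolP [forall a in A, #|a| <= 2]; first by left.
rewrite negb_forall_in => /exists_inP[a aA a3]; right=> b bB.
have [x xa xb] := obstruction_meet obs aA bB.
have [e /setUP[eA|eB] se] := obstruction_private obs aA bB xa xb xb; last first.
  exact: (obstruction_private_card obs aA bB xa xb eB).
rewrite (setUC a) in se.
by rewrite (obstruction_private_card (obstructionC obs) bB aA xb xa eA) // in a3.
Qed.

(** * From edges of size two to the exceptional families *)

Lemma complete_exceptional (V : finType) (A B : {set {set V}}) (b0 b1 : {set V}) :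
  obstruction A B -> b0 \in B -> b1 \in B -> [disjoint b0 & b1] ->
  (forall p q, p \in b0 -> q \in b1 -> [set p; q] \in A) ->
  exceptional A B.
Proof.
move=> obs b0B b1B dis full.
have b0E : b0 \in A :|: B by rewrite inE b0B orbT.
have b1E : b1 \in A :|: B by rewrite inE b1B orbT.
have [_ _ sz _] := obs.
have im (b : {set V}) : [set enum_val i | i : 'I_#|b|] = b.
  apply/setP=> x; apply/imsetP/idP => [[i _ ->]|xb]; first exact: enum_valP.
  by exists (enum_rank_in xb x); rewrite ?enum_rankK_in.
have AE : A = [set [set enum_val i; enum_val j] | i : 'I_#|b0|, j : 'I_#|b1|].
  apply/setP=> a; apply/idP/imset2P => [aA|[i j _ _ ->]]; last first.
    by apply: full; apply: enum_valP.
  have [p pa pb] := obstruction_meet obs aA b0B.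
  have [q qa qb] := obstruction_meet obs aA b1B.
  exists (enum_rank_in pb p) (enum_rank_in qb q); rewrite ?inE // !enum_rankK_in //.
  apply/esym/(obstruction_eq obs); rewrite ?inE ?full ?aA //.
  by rewrite subUset !sub1set pa.
have BE : B = [set b0; b1].
  apply/setP=> b; rewrite !inE; apply/idP/orP => [bB|[/eqP->//|/eqP->//]].
  have bE : b \in A :|: B by rewrite inE bB orbT.
  (* An edge of [B] that misses some [p] of [b0] must meet every pair [[set p; q]] at [q], so it
     contains [b1]. *)
  have [s0|/subsetPn[p pb0 pb]] := boolP (b0 \subset b).
    by left; rewrite (obstruction_eq obs b0E bE).
  right; rewrite (obstruction_eq obs b1E bE) //; apply/subsetP=> q qb1.
  have [w] := obstruction_meet obs (full p q pb0 qb1) bB.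
  by rewrite !inE => /orP[/eqP->|/eqP->//]; rewrite (negPf pb).
exists #|b0|, #|b1|, enum_val, enum_val; rewrite !im; split=> //.
- by split; apply: sz.
- split; [exact: enum_val_inj | exact: enum_val_inj |] => i j.
  apply/eqP=> ij; have := enum_valP j; rewrite -ij.
  by rewrite (disjointFr dis) // enum_valP.
apply/setP=> x; rewrite !inE andbT negb_forall_in; apply/exists_inP/orP.
  case=> e; rewrite negbK AE BE inE => /orP[/imset2P[i j _ _ ->]|].
    by rewrite !inE => /orP[]/eqP->; [left|right]; apply: enum_valP.
  by rewrite !inE => /orP[]/eqP-> ->; [left|right].
by case=> xb; [exists b0|exists b1]; rewrite ?negbK.
Qed.

Lemma obstruction_graph_exceptional (V : finType) (A B : {set {set V}}) :
  obstruction A B -> (forall a, a \in A -> #|a| <= 2) ->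
  exceptional A B \/ exceptional B A.
Proof.
move=> obs A2.
have [[/set0Pn[a aA] /set0Pn[b0 b0B] _] _ _ _] := obs.
have pairA a' p q : a' \in A -> p \in a' -> q \in a' -> p != q -> a' = [set p; q].
  move=> a'A pa qa pq; apply/esym/eqP; rewrite eqEcard cards2 pq A2 // andbT.
  by rewrite subUset !sub1set pa.
have covered b z : b \in B -> z \in b -> exists2 a', a' \in A & z \in a'.
  move=> bB zb; have [x xa xb] := obstruction_meet obs aA bB.
  have [->|zx] := eqVneq z x; first by exists a.
  have [a' a'A /subsetP sa'] := obstruction_private_neq obs aA bB xa xb zb zx.
  exists a' => //; have [w wa' wb] := obstruction_meet obs a'A bB.
  by move: (sa' w wa'); rewrite !inE wb orbT orbF => /eqP<-.
(* [b1] is the private edge, with roles exchanged, of a vertex [y] of [a] outside [b0]. *)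
have [b1 b1B dis] : exists2 b1, b1 \in B & [disjoint b0 & b1].
  have [x xa xb] := obstruction_meet obs aA b0B.
  have [|y ya yx] := @obstruction_other _ _ _ obs a x; first by rewrite inE aA.
  have [b1 b1B /subsetP sb1] :=
    obstruction_private_neq (obstructionC obs) b0B aA xb xa ya yx.
  exists b1 => //; rewrite disjoint_subset; apply/subsetP=> w wb0; rewrite inE.
  apply/negP=> /sb1; rewrite !inE wb0 orbF => /eqP wy.
  by rewrite -(obstruction_inter1 obs aA b0B xa xb (y := y)) ?eqxx // -wy in yx.
have b0E : b0 \in A :|: B by rewrite inE b0B orbT.
have b1E : b1 \in A :|: B by rewrite inE b1B orbT.
have neq p q : p \in b0 -> q \in b1 -> p != q.
  by move=> pb qb; apply/eqP=> pq; have := disjointFr dis pb; rewrite pq qb.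
have A01 a' : a' \in A -> exists p q, [/\ p \in b0, q \in b1 & a' = [set p; q]].
  move=> a'A; have [p pa pb] := obstruction_meet obs a'A b0B.
  have [q qa qb] := obstruction_meet obs a'A b1B.
  by exists p, q; split=> //; apply: pairA (neq _ _ pb qb).
have B01 b : b \in B -> b \subset b0 :|: b1.
  move=> bB; apply/subsetP=> z /(covered b z bB)[a' /A01[p [q [pb qb ->]]]].
  by rewrite !inE => /orP[]/eqP->; rewrite ?pb ?qb ?orbT.
have pairB p q : p \in b0 -> q \in b1 -> [set p; q] \notin A -> [set p; q] \in B.
  move=> pb qb npq.
  (* An edge in the third set misses [b0], so it is in [B] and lies strictly inside [b1], which is
     impossible. The edge is therefore the pair itself. *)
  have [w|e eE] := @obstruction_cover _ _ _ obs [set p; q] (b0 :\ p) (~: b0 :\ q).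
    by rewrite !inE; case: (w == p); case: (w == q); case: (w \in b0).
  rewrite (negPf (obstruction_setD1 obs eE b0E pb)) /= => /orP[epq|/subsetP se].
    have [_ _ sz _] := obs.
    have e_pq : e = [set p; q].
      apply/eqP; rewrite eqEcard epq cards2 (neq _ _ pb qb) /=; exact: sz.
    by move: eE; rewrite inE e_pq (negPf npq).
  case/setUP: (eE) => [eA|eB].
    have [w we wb] := obstruction_meet obs eA b0B.
    by move: (se w we); rewrite !inE wb andbF.
  have/negP[] := obstruction_setD1 obs eE b1E qb; apply/subsetP=> w we.
  move: (se w we) (subsetP (B01 e eB) w we).
  by rewrite !inE => /andP[-> /negPf->].
have [/forall_inP full|] :=
  boolP [forall p in b0, [forall q in b1, [set p; q] \in A]].
  by left; apply: (complete_exceptional obs b0B b1B dis) => p q /full/forall_inP; apply.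
rewrite negb_forall_in => /exists_inP[x xb0]; rewrite negb_forall_in.
case/exists_inP=> y yb1 xyA; right.
have xyB := pairB x y xb0 yb1 xyA.
(* The edge of [A] through [z] must meet [[set x; y]], which is in [B]; this can only happen at
   [y]. *)
have zyA z : z \in b0 -> z != x -> [set z; y] \in A.
  move=> zb zx; have [a' a'A] := covered b0 z b0B zb.
  have [p [q [pb qb E]]] := A01 a' a'A; rewrite E in a'A *.
  have nzq := neq z q zb qb.
  rewrite !inE (negPf nzq) orbF => /eqP zp; rewrite -zp in a'A *.
  have [w] := obstruction_meet obs a'A xyB; rewrite !inE.
  case/orP=> /eqP->; first by rewrite (negPf zx) (negPf (neq z y zb yb1)).
  by rewrite eq_sym (negPf (neq x q xb0 qb)) /= => /eqP <-.
have xtA t : t \in b1 -> t != y -> [set x; t] \in A.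
  move=> tb ty; have [a' a'A] := covered b1 t b1B tb.
  have [p [q [pb qb E]]] := A01 a' a'A; rewrite E in a'A *.
  have npt := neq p t pb tb.
  rewrite !inE eq_sym (negPf npt) /= => /eqP tq; rewrite -tq in a'A *.
  have [w] := obstruction_meet obs a'A xyB; rewrite !inE.
  case/orP=> /eqP->; last by rewrite (negPf ty) eq_sym (negPf (neq x t xb0 tb)).
  by rewrite (negPf (neq p y pb yb1)) orbF => /eqP <-.
have [z zb0 zx] := obstruction_other obs x b0E.
have [t tb1 ty] := obstruction_other obs y b1E.
have ztB : [set z; t] \in B.
  apply: pairB => //; apply/negP=> ztA.
  have [w] := obstruction_meet obs ztA xyB; rewrite !inE.
  case/orP=> /eqP->; first by rewrite (negPf zx) (negPf (neq z y zb0 yb1)).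
  by rewrite (negPf ty) eq_sym (negPf (neq x t xb0 tb1)).
(* For any other [w] in [b0], the edge [[set w; y]] of [A] would be disjoint from [[set z; t]]. *)
have b0E2 : [set x; z] = b0.
  apply/eqP; rewrite eqEsubset subUset !sub1set xb0 zb0 /=; apply/subsetP=> w wb.
  rewrite !inE; have [//|wx] := eqVneq w x.
  have [v] := obstruction_meet obs (zyA w wb wx) ztB; rewrite !inE.
  case/orP=> /eqP->; first by rewrite (negPf (neq w t wb tb1)) orbF.
  by rewrite eq_sym (negPf (neq z y zb0 yb1)) eq_sym (negPf ty).
have b1E2 : [set y; t] = b1.
  apply/eqP; rewrite eqEsubset subUset !sub1set yb1 tb1 /=; apply/subsetP=> w wb.
  rewrite !inE; have [//|wy] := eqVneq w y.
  have [v] := obstruction_meet obs (xtA w wb wy) ztB; rewrite !inE.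
  case/orP=> /eqP->; first by rewrite eq_sym (negPf zx) (negPf (neq x t xb0 tb1)).
  by rewrite eq_sym (negPf (neq z w zb0 wb)).
(* With roles exchanged, the disjoint edges [[set z; y]] and [[set x; t]] of [A] are the two sides;
   the four pairs across are [b0], [b1], [[set x; y]] and [[set z; t]], all in [B]. *)
apply: (complete_exceptional (obstructionC obs) (zyA z zb0 zx) (xtA t tb1 ty)).
  rewrite disjoint_subset; apply/subsetP=> w; rewrite !inE => /orP[]/eqP->.
    by rewrite (negPf zx) (neq z t).
  by rewrite eq_sym (negPf (neq x y xb0 yb1)) eq_sym.
move=> p q; rewrite !inE => /orP[]/eqP-> /orP[]/eqP-> //.
- by rewrite setUC b0E2.
- by rewrite setUC.
- by rewrite b1E2.
Qed.

Theorem theorem1p5 (V : finType) (A B : {set {set V}})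
    (hcross : cross_intersecting A B)
    (hsperner : sperner (A :|: B))
    (hcol : exists k, colorable (A :|: B) k) :
  chi hcol <= 3 \/ (exceptional A B \/ exceptional B A).
Proof.
have [/chi_le|col3] := boolP (colorable (A :|: B) 3); first by left.
have obs : obstruction A B.
  by split=> // e; have [k /colorable_card_gt1] := hcol; apply.
right; case: (obstruction_card2 obs) => [|/(obstruction_graph_exceptional (obstructionC obs))].
  exact: obstruction_graph_exceptional obs.
by case; [right|left].
Qed.
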